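(* For every $n\geq 3$, $\gamma_{WC}(C_n)=s_{WC}(C_n)=\lfloor n/2\rfloor$, where $C_n$ is the cycle on $n$ vertices.
   Context: The (unbiased) Waiter-Client domination game on a graph $G$: in each round Dominator (Waiter) offers two unclaimed vertices of $G$, Staller (Client) picks one for himself and the other goes to Dominator; if in the last round only one unclaimed vertex remains, it goes to Staller. Dominator wins if she claims all vertices of some dominating set of $G$. $\gamma_{WC}(G)$ is the smallest number of rounds within which Dominator can always occupy a dominating set, and $s_{WC}(G)$ is the smallest size of a dominating set Dominator can always claim (both $\infty$ if Dominator cannot win). *)

(* Defs.v *)
From mathcomp Require Import all_boot boolp.

Set Implicit Arguments.
Unset Strict Implicit.
Unset Printing Implicit Defensive.

(* A finite simple graph is given by its adjacency relation [e : rel V], meant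
   to be symmetric and irreflexive. *)

Definition dominating (V : finType) (e : rel V) (B : {set V}) : bool :=
  [forall v, (v \in B) || [exists u in B, e u v]].

(* [waiter_can goal k D S]: from the position where Dominator (Waiter) has
   claimed [D] and Staller (Client) has claimed [S], Dominator can ensure that
   within at most [k] further rounds her set satisfies [goal].  In a regular
   round she offers unclaimed [x != y], and both answers of Staller (keeping
   [x], or keeping [y]) must be good for her; when a single vertex [x] is left,
   the round consists of Staller getting [x]. *)
Fixpoint waiter_can (V : finType) (goal : pred {set V}) (k : nat)
    (D S : {set V}) : bool :=
  goal D ||
  (if k is k'.+1 then
     let U := ~: (D :|: S) in
     [exists x in U, exists y in U,
        [&& x != y, waiter_can goal k' (y |: D) (x |: S)
                  & waiter_can goal k' (x |: D) (y |: S)]]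
     || [exists x, (U == [set x]) && waiter_can goal k' D (x |: S)]
   else false).

Definition occupies_dominating (V : finType) (e : rel V) : pred {set V} :=
  fun D => [exists B : {set V}, (B \subset D) && dominating e B].

Definition occupies_dominating_le (V : finType) (e : rel V) (s : nat) :
    pred {set V} :=
  fun D => [exists B : {set V},
              [&& B \subset D, dominating e B & #|B| <= s]].

(* The least natural number satisfying [P]; [None] stands for infinity. *)
Definition least (P : pred nat) : option nat :=
  match pselect (exists k, P k) with
  | left exP => Some (ex_minn exP)
  | right _ => None
  end.

Definition gammaWC (V : finType) (e : rel V) : option nat :=
  least (fun k => waiter_can (occupies_dominating e) k set0 set0).

(* The whole game lasts [uphalf #|V|] rounds: two vertices per round, except
   for a possible last round with a single vertex. *)
Definition sWC (V : finType) (e : rel V) : option nat :=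
  least (fun s =>
    waiter_can (occupies_dominating_le e s) (uphalf #|V|) set0 set0).

(* [ordS] is the cyclic successor on ['I_n]; this is a simple graph, the cycle
   on n vertices, only for 3 <= n. *)
Definition cycle_graph (n : nat) : rel 'I_n :=
  fun i j => (ordS i == j) || (ordS j == i).

(* Main.v *)
Require Import Defs.
From mathcomp Require Import all_boot.
From mathcomp Require Import boolp zify.

(* Dominator wins in n/2 rounds by pairing: she first offers two adjacent
   vertices and then the other vertices in consecutive pairs, the vertex left
   over for odd n being a neighbour of the first vertex she got.

   For the lower bound, Staller always takes the same, say right, end of the
   offered edge, so that the claimed vertices form dominoes (Dominator, Staller).
   If Dominator offers a nonadjacent pair, or an edge separated by an odd number
   of free vertices from the preceding domino, then Staller can instead aim at
   owning a whole closed neighbourhood.  Otherwise Dominator's vertices are pairwise nonadjacent, so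
   none of them is redundant, and they do not dominate as long as two vertices
   are unclaimed. *)

Set Implicit Arguments.
Unset Strict Implicit.
Unset Printing Implicit Defensive.

(** * The game on an arbitrary finite vertex set *)

Section WaiterGame.

Variable V : finType.
Implicit Types (D S B : {set V}) (goal : pred {set V}).

Lemma waiter_can_mono goal1 goal2 k D S :
    (forall B, goal1 B -> goal2 B) ->
  waiter_can goal1 k D S -> waiter_can goal2 k D S.
Proof.
move=> sub; elim: k D S => [|k IHk] D S /=; first by rewrite !orbF; apply: sub.
case/or3P=> [/sub -> //|/exists_inP[x xU /exists_inP[y yU /and3P[xy w1 w2]]]|].
  apply/or3P; constructor 2; apply/exists_inP; exists x => //.
  by apply/exists_inP; exists y => //; rewrite xy !IHk.
case/existsP=> x /andP[Ux w]; apply/or3P; constructor 3.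
by apply/existsP; exists x; rewrite Ux IHk.
Qed.

Lemma waiter_can_le goal k l D S :
  k <= l -> waiter_can goal k D S -> waiter_can goal l D S.
Proof.
elim: k l D S => [|k IHk] [|l] D S //=; first by rewrite orbF => _ ->.
move=> kl.
case/or3P=> [-> //|/exists_inP[x xU /exists_inP[y yU /and3P[xy w1 w2]]]|].
  apply/or3P; constructor 2; apply/exists_inP; exists x => //.
  by apply/exists_inP; exists y => //; rewrite xy !(IHk l).
case/existsP=> x /andP[Ux w]; apply/or3P; constructor 3.
by apply/existsP; exists x; rewrite Ux (IHk l).
Qed.

Lemma waiter_can_full goal k D S :
  D :|: S = setT -> waiter_can goal k D S = goal D.
Proof.
move=> full; case: k => [|k] /=; rewrite ?orbF // full setCT.
case: (goal D) => //=; apply/negbTE; rewrite negb_or; apply/andP; split.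
  by apply/exists_inPn => x; rewrite inE.
by apply/existsPn => x; rewrite negb_and eq_sym -cards_eq0 cards1.
Qed.

(** An invariant that Staller can keep by one of his two answers is a strategy for him. The final
    one-vertex round needs no clause: it leaves [D] unchanged and fills the board. *)
Lemma staller_invariant (P : {set V} -> {set V} -> Prop) goal k D S :
    (forall D S, P D S -> ~~ goal D) ->
    (forall D S x y, P D S -> x \notin D :|: S -> y \notin D :|: S -> x != y ->
       P (y |: D) (x |: S) \/ P (x |: D) (y |: S)) ->
  P D S -> ~~ waiter_can goal k D S.
Proof.
move=> Pgoal Pmove; elim: k D S => [|k IHk] D S PDS /=.
  by rewrite orbF (Pgoal _ _ PDS).
rewrite !negb_or (Pgoal _ _ PDS) //=; apply/andP; split.
  apply/exists_inPn => x; rewrite inE => xU; apply/exists_inPn => y.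
  rewrite inE => yU; apply/negP => /and3P[xy].
  by case: (Pmove _ _ _ _ PDS xU yU xy) => /IHk/negbTE ->.
apply/existsPn => x; apply/negP => /andP[/eqP Ux].
rewrite waiter_can_full; first exact/negP/(Pgoal _ _ PDS).
by rewrite setUCA -[D :|: S]setCK Ux setUCr.
Qed.

Lemma waiter_pairing goal (ps : seq (V * V)) D S :
    uniq (unzip1 ps ++ unzip2 ps) ->
    {in unzip1 ps ++ unzip2 ps, forall x, x \notin D :|: S} ->
    (forall B, D \subset B -> #|B| <= #|D| + size ps ->
       {in ps, forall p, (p.1 \in B) || (p.2 \in B)} -> goal B) ->
  waiter_can goal (size ps) D S.
Proof.
elim: ps D S => [|[x y] ps IHps] D S /=.
  by move=> _ _ H; rewrite H ?addn0.
rewrite -(cat1s y) uniq_catCA mem_cat /= inE mem_cat !negb_or -!andbA.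
case/and5P=> xps1 xy xps2 yps1 /andP[yps2 ups] fr gl.
have xU : x \notin D :|: S by apply: fr; rewrite inE eqxx.
have yU : y \notin D :|: S by apply: fr; rewrite !(inE, mem_cat) eqxx !orbT.
have step u v : u \notin D :|: S -> u \notin unzip1 ps -> u \notin unzip2 ps ->
    v \notin unzip1 ps -> v \notin unzip2 ps -> (u, v) \in [:: (x, y); (y, x)] ->
    waiter_can goal (size ps) (u |: D) (v |: S).
  move=> uU u1 u2 v1 v2 uv; apply: IHps.
  - exact: ups.
  - move=> z zps; have := fr z; rewrite !inE !mem_cat !inE in zps *.
    have -> : (z == u) = false.
      by apply/eqP=> zu; case/orP: zps; rewrite zu ?(negbTE u1) ?(negbTE u2).
    have -> : (z == v) = false.
      by apply/eqP=> zv; case/orP: zps; rewrite zv ?(negbTE v1) ?(negbTE v2).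
    by move=> /= -> //; case/orP: zps => ->; rewrite ?orbT.
  move=> B sB cB hB; apply: gl.
  - by apply: subset_trans sB; apply: subsetUr.
  - move: uU; rewrite inE negb_or => /andP[uD _].
    by move: cB; rewrite cardsU1 uD add1n addSn addnS.
  have uB : u \in B by apply: (subsetP sB); rewrite !inE eqxx.
  move=> p; rewrite inE => /predU1P[-> /=|]; last exact: hB.
  by move: uv; rewrite !inE !xpair_eqE => /orP[]/andP[/eqP<- _]; rewrite uB ?orbT.
apply/or3P; constructor 2; apply/exists_inP; exists x; rewrite ?inE ?xU //.
  by move: xU; rewrite !inE.
apply/exists_inP; exists y; first by move: yU; rewrite !inE.
rewrite xy /=; apply/andP; split; apply: step => //; rewrite !inE eqxx ?orbT //.
Qed.

Lemma disjoint_move D S x y : [disjoint D & S] ->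
    x \notin D :|: S -> y \notin D :|: S -> x != y ->
  [disjoint x |: D & y |: S].
Proof.
rewrite !inE !negb_or => dDS /andP[xD xS] /andP[yD yS] xy.
rewrite -setI_eq0; apply/eqP/setP=> z; rewrite !inE; apply/negbTE.
apply/negP=> /andP[/predU1P[->|zD] /predU1P[Ez|zS]].
- by rewrite Ez eqxx in xy.
- by rewrite zS in xS.
- by rewrite -Ez zD in yD.
- by rewrite (disjointFr dDS zD) in zS.
Qed.

(** Dominator gains at most one vertex per round, so a lower bound on sizes is also one on
    rounds. *)
Lemma waiter_can_occupies_le (e : rel V) k D S :
    [disjoint D & S] ->
  waiter_can (occupies_dominating e) k D S ->
  waiter_can (occupies_dominating_le e (#|D| + k)) k D S.
Proof.
elim: k D S => [|k IHk] D S dDS; rewrite /= ?orbF.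
  case/existsP=> B /andP[sB dB]; apply/existsP; exists B.
  by rewrite sB dB addn0 subset_leq_card.
have base : occupies_dominating e D -> occupies_dominating_le e (#|D| + k.+1) D.
  case/existsP=> B /andP[sB dB]; apply/existsP; exists B.
  by rewrite sB dB (leq_trans (subset_leq_card sB)) ?leq_addr.
case/or3P=> [/base-> //|/exists_inP[x xU /exists_inP[y yU /and3P[xy w1 w2]]]|].
  have xU' : x \notin D :|: S by rewrite -in_setC.
  have yU' : y \notin D :|: S by rewrite -in_setC.
  have card z : z \notin D :|: S -> #|D| + k.+1 = #|z |: D| + k.
    by rewrite inE negb_or => /andP[zD _]; rewrite cardsU1 zD add1n addnS.
  apply/or3P; constructor 2; apply/exists_inP; exists x => //.
  apply/exists_inP; exists y => //; rewrite xy /= {1}(card _ yU') (card _ xU').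
  by rewrite !IHk ?disjoint_move // eq_sym.
case/existsP=> x /andP[/eqP Ux w]; apply/or3P.
move: w; have full : D :|: (x |: S) = setT.
  by rewrite setUCA -[D :|: S]setCK Ux setUCr.
by rewrite waiter_can_full // => /base ->; constructor 1.
Qed.

End WaiterGame.

Lemma least_eq (P : pred nat) m :
  P m -> (forall k, k < m -> ~~ P k) -> least P = Some m.
Proof.
move=> Pm minm; rewrite /least; case: pselect => [exP|[]]; last by exists m.
congr Some; apply/eqP; rewrite eqn_leq; case: ex_minnP => k Pk mink.
by rewrite mink //= leqNgt; apply/negP => /minm; rewrite Pk.
Qed.

(** * Positions on the cycle *)

Section CycleGame.

Variable n : nat.
Implicit Types (x v : 'I_n) (D S B : {set 'I_n}).

(** Counting positions as natural numbers from a base vertex turns arcs into integer intervals,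
    within reach of [lia]; positions below [n] are distinct vertices. *)
Definition around x (j : nat) : 'I_n := iter j (@ordS n) x.
Arguments around : simpl never.

Lemma aroundS x j : around x j.+1 = ordS (around x j).
Proof. by []. Qed.

Lemma val_around x j : around x j = (x + j) %% n :> nat.
Proof.
elim: j => [|j IHj]; first by rewrite addn0 modn_small.
by rewrite aroundS /= IHj -addn1 modnDml addn1 addnS.
Qed.

Lemma around_wrap x : around x n = x.
Proof. by apply: val_inj; rewrite /= val_around modnDr modn_small. Qed.

Lemma around_add x i j : around (around x i) j = around x (i + j).
Proof. by rewrite /around addnC iterD. Qed.

Lemma around_eq x i j : i < n -> j < n -> (around x i == around x j) = (i == j).
Proof.
move=> ltin ltjn; rewrite -val_eqE /= !val_around eqn_modDl.
by rewrite !modn_small.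
Qed.

Lemma around_surj x v : exists2 j, j < n & v = around x j.
Proof.
have n_gt0 : 0 < n by apply: leq_ltn_trans (ltn_ord x).
exists ((v + (n - x)) %% n); first exact: ltn_pmod.
apply: val_inj; rewrite /= val_around modnDmr addnCA subnKC ?modnDr ?modn_small //.
exact: ltnW.
Qed.

Lemma around_in_setU1 x i j B :
  i < n -> j < n -> (around x i \in around x j |: B) = (i == j) || (around x i \in B).
Proof. by move=> ltin ltjn; rewrite in_setU1 around_eq. Qed.

(** Closed neighbourhoods in the cycle are triples of consecutive vertices, indexed here by the
    first one instead of the centre. *)
Lemma dominating_cycleP B :
  reflect (forall x, [|| around x 0 \in B, around x 1 \in B | around x 2 \in B])
          (dominating (@cycle_graph n) B).
Proof.
apply: (iffP forallP) => dB x.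
  case/orP: (dB (around x 1)) => [->|/exists_inP[u uB]]; first by rewrite orbT.
  rewrite /cycle_graph => /orP[/eqP/(can_inj (@ordSK n)) Eu|/eqP Eu].
    by rewrite -[around x 0]Eu uB.
  by rewrite [around x 2]Eu uB !orbT.
have [y ->] : exists y, x = around y 1.
  by exists (ord_pred x); rewrite /around /= ord_predK.
have/or3P[yB|->//|yB] := dB y; apply/orP; right; apply/exists_inP.
  by exists (around y 0); rewrite // /cycle_graph eqxx.
by exists (around y 2); rewrite // /cycle_graph eqxx orbT.
Qed.

Lemma not_occupies_le s x i D :
    (forall j, i <= j <= i.+2 -> around x j \notin D) ->
  ~~ occupies_dominating_le (@cycle_graph n) s D.
Proof.
move=> noD; apply/existsPn => B; apply/negP=> /and3P[/subsetP sB].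
move/dominating_cycleP/(_ (around x i)); rewrite !around_add.
by case/or3P=> /sB xD _; move: xD; apply/negP; apply: noD; lia.
Qed.

(** * Dominator's pairing strategy *)

Section Waiter.

Hypothesis n_ge3 : 3 <= n.

Lemma waiter_can_cycle :
  waiter_can (occupies_dominating_le (@cycle_graph n) n./2) n./2 set0 set0.
Proof.
have x0 : 'I_n by apply: (@Ordinal n 0); lia.
have n2 : n./2 = (n./2).-1.+1 by lia.
(* After the first answer the remaining vertices are paired consecutively; for
   odd [n] the vertex left over must be adjacent to the one just claimed. *)
pose ps c := [seq (around x0 (c + i.*2), around x0 (c + i.*2).+1) 
               | i <- iota 1 (n./2).-1].
have play (b : bool) D S : D = [set around x0 b] -> S = [set around x0 (~~ b)] ->
    waiter_can (occupies_dominating_le (@cycle_graph n) n./2) (n./2).-1 D S.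
  (* Dominator holds position [b]. With [c = 0] the pairs start at position 2, and for odd [n]
     position [n.-1] is left over, next to 0; with [c = 1] they start at 3, and position 2 is left
     over, next to 1. *)
  move=> ED ES; pose c : nat := b && odd n.
  have c_odd : c <= odd n by rewrite /c; case: (odd n) (b) => -[].
  have c_b : c <= b by rewrite /c; case: (odd n) (b) => -[].
  have b_c : odd n -> c = b by rewrite /c => ->; rewrite andbT.
  have b1 : b <= 1 by case: (b).
  have nb : ~~ b = 1 - b :> nat by case: (b).
  rewrite {}nb in ES.
  have <- : size (ps c) = (n./2).-1 by rewrite size_map size_iota.
  apply: waiter_pairing.
  - rewrite /unzip1 /unzip2 -!map_comp.
    rewrite cat_uniq !map_inj_in_uniq ?iota_uniq /= ?andbT.
    + apply/hasPn => _ /mapP[j jin ->]; apply/mapP => -[i iin /eqP /=].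
      rewrite !mem_iota /= in iin jin *; rewrite around_eq; lia.
    + move=> i j; rewrite !mem_iota /= => iin jin /eqP /=; rewrite around_eq; lia.
    + move=> i j; rewrite !mem_iota /= => iin jin /eqP /=; rewrite around_eq; lia.
  - rewrite /unzip1 /unzip2 -!map_comp => z; rewrite mem_cat => /orP[]/mapP[j].
      rewrite mem_iota /= => jin ->.
      by rewrite ED ES !inE !around_eq; lia.
    rewrite mem_iota /= => jin ->.
    by rewrite ED ES !inE !around_eq; lia.
  move=> B sB cB hB; apply/existsP; exists B; rewrite subxx /=; apply/andP; split.
    have bB : around x0 b \in B by apply: (subsetP sB); rewrite ED inE.
    pose dom v := (v \in B) || [exists u in B, cycle_graph u v].
    have self j : around x0 j \in B -> dom (around x0 j) by rewrite /dom => ->.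
    have up j : around x0 j.+1 \in B -> dom (around x0 j).
      move=> jB; apply/orP; right; apply/exists_inP; exists (around x0 j.+1) => //.
      by rewrite /cycle_graph aroundS eqxx orbT.
    have down j : around x0 j \in B -> dom (around x0 j.+1).
      move=> jB; apply/orP; right; apply/exists_inP; exists (around x0 j) => //.
      by rewrite /cycle_graph aroundS eqxx.
    apply/forallP => v; have [j ltjn ->] := around_surj x0 v; rewrite -/(dom _).
    (* Positions up to [c.+1] are [b] itself or a neighbour of it. *)
    have [j_c|c_j] := leqP j c.+1.
      have [->|[->|Ej]] : j = b \/ j = b.+1 \/ j.+1 = b by lia.
      - exact: self.
      - exact: down.
      - by apply: up; rewrite Ej.
    pose i := (j - c)./2.
    have [lt_i|ge_i] := ltnP i n./2.
      have /hB : (around x0 (c + i.*2), around x0 (c + i.*2).+1) \in ps c.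
        by apply: map_f; rewrite mem_iota; lia.
      have [->|->] : j = c + i.*2 \/ j = (c + i.*2).+1 by lia.
        by case/orP; [apply: self | apply: up].
      by case/orP; [apply: down | apply: self].
    (* Beyond the last pair there is only position [n.-1], for odd [n] and [b = 0]; its successor
       wraps around to 0. *)
    apply: up; have [-> Eb] : j.+1 = n /\ b = 0 :> nat by lia.
    by rewrite around_wrap; rewrite Eb in bB.
  by apply: leq_trans cB _; rewrite ED cards1 size_map size_iota; lia.
rewrite n2 /=; apply/or3P; constructor 2; apply/exists_inP.
exists (around x0 0); first by rewrite !inE.
apply/exists_inP; exists (around x0 1); first by rewrite !inE.
rewrite around_eq; [rewrite /=|lia|lia].
rewrite -n2 !setU0; apply/andP; split; last exact: (play false).
exact: (play true).
Qed.

End Waiter.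

(** * Staller's patterns and his replies *)

Section Staller.

Variable x : 'I_n.
Local Notation f := (around x).

Definition free D S j := (f j \notin D) && (f j \notin S).

(* Positions, read along a linear stretch of the cycle, in which Staller is
   sure to obtain a whole closed neighbourhood: Dominator never gets to claim the
   missing vertex of a window, and in the two other cases every further offer
   meeting the pattern leaves Staller such a position again. *)
Inductive stuck D S : Prop :=
| StuckWindow i j k of i.+2 < n & forall h, i <= h <= i.+2 -> f h \notin D
    & i <= j < k & k <= i.+2 & f j \in S & f k \in S
| StuckGap i of i.+3 < n & free D S i & free D S i.+1 & f i.+2 \in S
    & free D S i.+3
| StuckRun i l of i + l < n & ~~ odd l & 0 < l & f i \in S & f (i + l) \in S
    & forall j, i < j < i + l -> free D S j.

Lemma free_move D S a b j : a < n -> b < n -> j < n ->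
  free (f b |: D) (f a |: S) j = [&& j != a, j != b & free D S j].
Proof.
move=> lta ltb ltj; rewrite /free !around_in_setU1 // !negb_or.
by case: (j == a); case: (j == b); rewrite /= ?andbF.
Qed.

Lemma free_neq D S a j : free D S a -> f j \in S -> (j == a) = false.
Proof. by move=> /andP[_ aS] jS; apply: contraNF aS => /eqP <-. Qed.

Lemma in_move S a j : f j \in S -> f j \in f a |: S.
Proof. exact/subsetP/subsetUr. Qed.

Lemma notin_move D b j :
  b < n -> j < n -> j != b -> f j \notin D -> f j \notin f b |: D.
Proof. by move=> ltb ltj jb jD; rewrite around_in_setU1 // negb_or jb. Qed.

Lemma stuck_window_take D S a b i c :
    a < n -> b < n -> i.+2 < n -> (forall h, i <= h <= i.+2 -> f h \notin D) ->
    ~~ (i <= b <= i.+2) -> i <= a <= i.+2 -> i <= c <= i.+2 -> a != c -> f c \in S ->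
  stuck (f b |: D) (f a |: S).
Proof.
move=> lta ltb lti noD bi ai ci ac cS.
have noD' h : i <= h <= i.+2 -> f h \notin f b |: D.
  by move=> hi; apply: notin_move; [| | |exact: noD]; lia.
have aS : f a \in f a |: S := setU11 _ _; have cS' := in_move a cS.
have [lt_ac|ge_ac] := ltnP a c.
  by apply: (@StuckWindow _ _ i a c); rewrite //; lia.
by apply: (@StuckWindow _ _ i c a); rewrite //; lia.
Qed.

(** At even distance from [m], keeping [a] closes a run. At odd distance [a.+1] helps: it completes
    a window if [a] is next to [m] or [a.+1] is Staller's, and otherwise the gap pattern around
    [a]. *)
Lemma stuck_take D S a b m :
    [disjoint D & S] -> a.+1 < n -> b < n -> m < a -> f m \in S ->
    free D S a -> (forall j, m < j < a -> free D S j) ->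
    (b < m) || (a < b) ->
    ~~ odd (a - m) \/ (f a.+1 \notin D /\ b != a.+1) ->
  stuck (f b |: D) (f a |: S).
Proof.
move=> dDS lta ltb ltma mS fra run b_out.
have noD j : f j \in S -> f j \notin D by move=> jS; rewrite (disjointFl dDS jS).
have noDm j : m <= j <= a -> f j \notin D.
  move=> /andP[mj ja]; have [->|jm] := eqVneq j m; first exact: noD.
  have [->|jna] := eqVneq j a; first by case/andP: fra.
  by have /andP[] : free D S j by apply: run; lia.
case E: (odd (a - m)); last first.
  have Ea := subnKC (ltnW ltma).
  move=> _; apply: (@StuckRun _ _ m (a - m));
    rewrite ?E ?Ea ?subn_gt0 ?setU11 ?in_move //.
    exact: ltnW.
  by move=> j jin; rewrite free_move ?run; lia.
case=> // -[a1D ba1]; have [Em|gt_a] := eqVneq a m.+1.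
  apply: (@stuck_window_take _ _ _ _ m m) => //; try lia.
  move=> h hin; have [->//|ha] := eqVneq h a.+1.
  by apply: noDm; lia.
(* Oddness of [a - m] excludes [m.+2], so the two vertices before [a] are free. *)
have {}gt_a : m.+3 <= a by lia.
have [a1S|a1S] := boolP (f a.+1 \in S).
  apply: (@stuck_window_take _ _ _ _ a.-1 a.+1) => //; try lia.
  move=> h hin; have [->//|ha] := eqVneq h a.+1.
  by apply: noDm; lia.
have Ea : a.-2.+2 = a by lia.
have fr2 : free D S a.-2 by apply: run; lia.
have fr1 : free D S a.-2.+1 by apply: run; lia.
have fr3 : free D S a.+1 by rewrite /free a1D.
have [b2 b1] : a.-2 != b /\ a.-2.+1 != b by clear -b_out gt_a; lia.
have [a2 a1] : a.-2 != a /\ a.-2.+1 != a by clear -gt_a; lia.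
have [b3 a3] : a.+1 != b /\ a.+1 != a by rewrite eq_sym ba1 (gtn_eqF (leqnn _)).
have [lta0 lta2 lta1] : [/\ a < n, a.-2 < n & a.-2.+1 < n] by clear -lta; split; lia.
apply: (@StuckGap _ _ a.-2).
- by rewrite Ea.
- by rewrite free_move // a2 b2.
- by rewrite free_move // a1 b1.
- by rewrite Ea setU11.
- by rewrite Ea free_move // a3 b3.
Qed.

(** A window lacks at most one vertex, and Staller keeps it when it is offered. In a run he keeps
    the first offered interior vertex, with one exception treated below. *)
Lemma stuck_move D S a b : [disjoint D & S] -> a < b < n ->
    free D S a -> free D S b -> stuck D S ->
  stuck (f b |: D) (f a |: S) \/ stuck (f a |: D) (f b |: S).
Proof.
move=> dDS /andP[ltab ltb] fra frb; have lta : a < n by apply: ltn_trans ltb.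
have noD j : f j \in S -> f j \notin D by move=> jS; rewrite (disjointFl dDS jS).
case=> [i j k lti iD /andP[ij jk] ki jS kS|i lti f0 f1 s2 f3|
  i l lti l_even l_gt0 si sl run].
- have jk_ab := (free_neq fra jS, free_neq fra kS, free_neq frb jS, free_neq frb kS).
  have keep (u v : nat) : v < n -> ~~ (i <= v <= i.+2) -> stuck (f v |: D) (f u |: S).
    move=> ltv vi; apply: (@StuckWindow _ _ i j k); rewrite ?in_move ?ij //.
    by move=> h hi; apply: notin_move; [| | |exact: iD]; lia.
  have [bw|bw] := boolP (i <= b <= i.+2); last by (left; apply: keep).
  right; apply: keep => //; apply/negP => aw.
  by case: jk_ab => -[[]]; lia.
- have na2 := free_neq fra s2; have nb2 := free_neq frb s2.
  have winD h : i <= h <= i.+3 -> f h \notin D.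
    move=> hi; have : [|| h == i, h == i.+1, h == i.+2 | h == i.+3] by lia.
    by case/or4P=> /eqP->; [case/andP: f0|case/andP: f1|apply: noD|case/andP: f3].
  (* Staller keeps [i.+1] if it is offered, otherwise [i] or [i.+3]; together with [i.+2] it lies in
     a window that misses Dominator's new vertex. *)
  have win (u v : nat) : u < n -> v < n -> i.+2 != u -> i.+2 != v -> u != v ->
      (u == i.+1) || ((u == i.+3) || (u == i)) && (v != i.+1) ->
      stuck (f v |: D) (f u |: S).
    move=> ltu ltv nu nv uv c.
    have [w|w] := boolP ((u == i.+3) || (u == i.+1) && (v != i.+3)).
      apply: (@stuck_window_take _ _ _ _ i.+1 i.+2) => //; try lia.
      by move=> h hi; apply: winD; lia.
    apply: (@stuck_window_take _ _ _ _ i i.+2) => //; try lia.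
    by move=> h hi; apply: winD; lia.
  have [c|c] := boolP ((a == i.+1) || ((a == i.+3) || (a == i)) && (b != i.+1)).
    by left; apply: win; rewrite ?na2 ?nb2 //; lia.
  have [c'|c'] := boolP ((b == i.+1) || ((b == i.+3) || (b == i)) && (a != i.+1)).
    by right; apply: win; rewrite ?na2 ?nb2 //; lia.
  left; apply: (@StuckGap _ _ i); rewrite ?in_move ?free_move ?f0 ?f1 ?f3 //; lia.
have nai := free_neq fra si; have nal := free_neq fra sl.
have nbi := free_neq frb si; have nbl := free_neq frb sl.
have notD j : i < j <= i + l -> f j \notin D.
  move=> /andP[ij]; rewrite leq_eqVlt => /predU1P[->|jl]; first exact: noD.
  by have /run/andP[] : i < j < i + l by rewrite ij.
have [ain|aout] := boolP (i < a < i + l).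
  have runa j : i < j < a -> free D S j by move=> jin; apply: run; lia.
  have [E|E] := boolP (~~ odd (a - i) || (b != a.+1)).
    left; apply: (@stuck_take _ _ _ _ i) => //; try lia.
    by case/orP: E => E; [left|right; split=> //; apply: notD; lia].
  (* Here [b = a.+1] and [a - i] is odd: keeping [b] leaves a run from [b] to [i + l], again of even
     length. *)
  have ltbl : b < i + l by lia.
  have El := subnKC (ltnW ltbl).
  right; apply: (@StuckRun _ _ b (i + l - b)); rewrite ?El ?subn_gt0 ?setU11 ?in_move //.
    lia.
  by move=> j jin; rewrite free_move ?run; lia.
have [bin|bout] := boolP (i < b < i + l).
  have runb j : i < j < b -> free D S j by move=> jin; apply: run; lia.
  right; apply: (@stuck_take _ _ _ _ i) => //; try lia.
  by right; split; [apply: notD|]; lia.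
left; apply: (@StuckRun _ _ i l); rewrite ?in_move //.
by move=> j jin; rewrite free_move ?run //; lia.
Qed.

(** Each pattern contains three consecutive vertices outside [D]; in a run these are the first
    three, as parity gives [l >= 2]. *)
Lemma stuck_not_occupies s D S : [disjoint D & S] -> stuck D S ->
  ~~ occupies_dominating_le (@cycle_graph n) s D.
Proof.
move=> dDS.
have noD j : f j \in S -> f j \notin D by move=> jS; rewrite (disjointFl dDS jS).
case=> [i _ _ _ iD _ _ _ _|i lti /andP[d0 _] /andP[d1 _] s2 _|
  i l lti l_even l_gt0 si sl run].
- exact: (@not_occupies_le _ x i).
- apply: (@not_occupies_le _ x i) => j jin.
  have [->//|[->//|->]] : j = i \/ j = i.+1 \/ j = i.+2 by clear -jin; lia.
  exact: noD.
apply: (@not_occupies_le _ x i) => j jin.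
have [->|j_i] := eqVneq j i; first exact: noD.
have [->|j_l] := eqVneq j (i + l); first exact: noD.
by have /andP[] : free D S j by apply: run; lia.
Qed.


(* Every vertex claimed by Staller directly follows one claimed by Dominator, and
   all free gaps between these dominoes, except possibly the last one, have even
   length. *)
Record oriented D S : Prop := Oriented {
  oriented_disjoint : [disjoint D & S];
  oriented0 : f 0 \in S;
  oriented_succ : forall v, (v \in D) = (ordS v \in S);
  oriented_odd : forall j, j.+1 < n -> f j \in D -> odd j }.

(** Position 0 is Staller's, hence its predecessor [n.-1] is Dominator's. *)
Lemma oriented_free_bounds D S a :
  oriented D S -> a < n -> free D S a -> 0 < a /\ a.+1 < n.
Proof.
case=> dDS S0 succ oddD lta fra; split.
  by rewrite lt0n eq_sym (free_neq fra S0).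
rewrite ltn_neqAle lta andbT; apply/eqP => Ea.
by case/andP: fra; rewrite succ -aroundS Ea around_wrap -[x]/(f 0) S0.
Qed.

(** Take the last vertex of Staller before [a]. It is even because it is 0 or follows an odd vertex
    of Dominator; a later vertex of Dominator before [a] would be followed by one more of
    Staller. *)
Lemma oriented_last D S a : oriented D S -> a < n -> free D S a ->
  exists m, [/\ m < a, ~~ odd m, f m \in S & forall j, m < j < a -> free D S j].
Proof.
move=> ori lta fra; have [a_gt0 lta1] := oriented_free_bounds ori lta fra.
case: ori => dDS S0 succ oddD.
pose Q m := (m < a) && (f m \in S).
have exQ : exists m, Q m by exists 0; rewrite /Q a_gt0.
have ubQ m : Q m -> m <= a by case/andP=> /ltnW.
case: (ex_maxnP exQ ubQ) => m /andP[ltma mS] maxm.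
exists m; split=> //.
  case: m mS ltma {maxm} => // m; rewrite aroundS -succ => mD ltma.
  by rewrite /= negbK oddD //; lia.
move=> j /andP[ltmj ltja]; apply/andP; split; apply/negP => jin; last first.
  by have := maxm j; rewrite /Q ltja jin leqNgt ltmj => /(_ isT).
have j1S : f j.+1 \in S by rewrite aroundS -succ.
have := maxm j.+1; rewrite /Q j1S andbT ltn_neqAle ltja andbT (free_neq fra j1S).
by move=> /(_ isT); rewrite leqNgt ltnS ltnW.
Qed.

(** If [a] is even, keeping it closes a run back to Staller's previous vertex. If [a] is odd and [b]
    is not its successor, [a.+1] is even and so not in [D], and [stuck_take] applies again. Only an
    edge starting at an odd position continues the dominoes. *)
Lemma oriented_move D S a b : oriented D S -> a < b < n ->
    free D S a -> free D S b ->
  stuck (f b |: D) (f a |: S) \/ oriented (f a |: D) (f b |: S).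
Proof.
move=> ori /andP[ltab ltb] fra frb; have lta := ltn_trans ltab ltb.
have [_ lta1] := oriented_free_bounds ori lta fra.
have [_ ltb1] := oriented_free_bounds ori ltb frb.
have [m [ltma m_even mS runa]] := oriented_last ori lta fra.
have [dDS S0 succ oddD] := ori.
have take := stuck_take dDS lta1 ltb ltma mS fra runa.
rewrite ltab orbT in take.
have [a_odd|a_even] := boolP (odd a); last first.
  by left; apply: take => //; left; clear -a_even m_even ltma; lia.
have [Eb|b_a1] := eqVneq b a.+1.
  right; split.
  - apply: disjoint_move => //; rewrite ?inE ?negb_or //.
    by rewrite around_eq // ltn_eqF.
  - exact: in_move.
  - move=> v; rewrite !in_setU1 succ Eb aroundS.
    by rewrite (inj_eq (can_inj (@ordSK n))).
  move=> j ltj; rewrite around_in_setU1 ?(ltnW ltj) //.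
  by case/predU1P=> [->|] //; apply: oddD.
left; apply: take => //; right; split=> //; apply/negP => /oddD.
by rewrite /= a_odd => /(_ _)/implyP; clear -ltab ltb1; lia.
Qed.

(** If [D] dominated, each free vertex would precede one of [D], since it cannot follow one; so
    every gap would be a single vertex. By parity only the last gap can be, yet [s < n./2] leaves
    two free vertices. *)
Lemma oriented_not_occupies s D S : s < n./2 -> oriented D S ->
  ~~ occupies_dominating_le (@cycle_graph n) s D.
Proof.
move=> lts ori; have [dDS S0 succ oddD] := ori.
apply/existsPn => B; apply/negP => /and3P[/subsetP sBD /forallP domB leBs].
have free_succ v : v \notin D :|: S -> ordS v \in D.
  rewrite inE negb_or => /andP[vD vS].
  have /orP[/sBD|/exists_inP[u /sBD uD]] := domB v; first by rewrite (negbTE vD).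
  rewrite /cycle_graph => /orP[]/eqP Eu; last by rewrite Eu.
  by move: uD; rewrite (succ u) Eu (negbTE vS).
(* [D] is independent, so no vertex of [D] can be spared. *)
have sDB : D \subset B.
  apply/subsetP => d dD; have /orP[//|/exists_inP[u /sBD uD]] := domB d.
  rewrite /cycle_graph => /orP[]/eqP Eu.
    by move: uD; rewrite (succ u) Eu (disjointFr dDS dD).
  by move: dD; rewrite (succ d) Eu (disjointFr dDS uD).
have cardS : #|S| = #|D|.
  rewrite -(card_imset (mem D) (can_inj (@ordSK n))); apply: eq_card => v.
  apply/idP/imsetP => [vS|[u uD ->]]; last by rewrite -succ.
  by exists (ord_pred v); rewrite ?succ ord_predK.
have : 1 < #|~: (D :|: S)|.
  have := cardsC (D :|: S); rewrite card_ord.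
  have := (leq_card_setU D S).1; rewrite cardS.
  have := leq_trans (subset_leq_card sDB) leBs.
  by move: lts; clear; lia.
have last_free i : i < n -> free D S i -> i.+2 = n.
  move=> lti fri; have [i_gt0 lti1] := oriented_free_bounds ori lti fri.
  have i1D : f i.+1 \in D by apply: free_succ; rewrite inE negb_or.
  have [m [ltmi m_even mS run]] := oriented_last ori lti fri.
  have Ei : i = m.+1.
    apply/eqP; rewrite eqn_leq ltmi andbT leqNgt; apply/negP => gt_i.
    have /free_succ : f i.-1 \notin D :|: S.
      by rewrite inE negb_or; apply: run; clear -gt_i; lia.
    by rewrite -aroundS prednK //; apply/negP; case/andP: fri.
  apply/eqP; rewrite eqn_leq lti1 leqNgt; apply/negP => /oddD/(_ i1D).
  by rewrite Ei /= negbK (negbTE m_even).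
case/card_gt1P=> y [z]; rewrite !in_setC !in_setU !negb_or.
have [[i lti ->] [j ltj ->]] := (around_surj x y, around_surj x z).
case=> fri frj; rewrite around_eq // => /eqP[].
by have := (last_free i lti fri, last_free j ltj frj); case=> <- [].
Qed.

End Staller.

(** * The first offer and the lower bound *)

Lemma first_adjacent v :
  3 <= n -> oriented (ordS v) [set v] [set ordS v].
Proof.
move=> n_ge3; have vv : v != ordS v.
  by rewrite -[v in v == _]/(around v 0) -[ordS v]/(around v 1) around_eq //; lia.
split.
- by rewrite disjoints1 inE.
- by rewrite inE.
- by move=> u; rewrite !inE (inj_eq (can_inj (@ordSK n))).
move=> j ltj; rewrite inE => /eqP Ej.
(* Counted from Staller's vertex, Dominator's sits at [n.-1], which the parity clause exempts. *)
have Ev : around (ordS v) n.-1 = v.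
  by apply: (can_inj (@ordSK n)); rewrite -aroundS prednK ?around_wrap //; lia.
have : around (ordS v) j == around (ordS v) n.-1 by rewrite Ej Ev.
by rewrite around_eq; lia.
Qed.

(** The bounds on [k] keep Dominator's vertex away from the two vertices before [v] and the one
    after it, so the gap pattern surrounds [v]. *)
Lemma first_far v k : 1 < k -> k.+2 < n ->
  stuck (around v (n - 2)) [set around v k] [set v].
Proof.
move=> k_gt1 ltk.
have Ev : around (around v (n - 2)) 2 = v.
  by rewrite around_add subnK ?around_wrap //; lia.
have E3 : around (around v (n - 2)) 3 = around v 1.
  by rewrite aroundS Ev.
have fr j : j < n -> j != k -> j != 0 -> around v j \notin [set around v k] /\
    around v j \notin [set v].
  move=> ltj jk j0; rewrite !inE -[X in _ /\ _ != X]/(around v 0).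
  by rewrite !around_eq //; lia.
apply: (@StuckGap _ _ _ 0); rewrite /free ?E3 ?Ev ?around_add ?inE //; try lia.
- by have [] := fr (n - 2); [lia|lia|lia|rewrite addn0 !inE => -> ->].
- by have [] := fr (n - 2 + 1); [lia|lia|lia|rewrite !inE => -> ->].
- by have [] := fr 1; [lia|lia|lia|rewrite !inE => -> ->].
Qed.

Lemma waiter_cannot_cycle s r : s < n./2 ->
  ~~ waiter_can (occupies_dominating_le (@cycle_graph n) s) r set0 set0.
Proof.
move=> lts; have n_gt0 : 0 < n by lia.
(* For [n < 5] no set of at most [s] vertices dominates, so any answers do. The first reply to two
   vertices at distance 2 needs [n >= 5]. *)
have [n_ge5|n_lt5] := leqP 5 n; last first.
  apply: (@staller_invariant _ (fun _ _ => True)) => // [D S _|]; last by left.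
  apply/existsPn => B; apply/negP => /and3P[_ /dominating_cycleP domB leBs].
  have : #|B| <= 1 by apply: leq_trans leBs _; lia.
  rewrite leq_eqVlt ltnS leqn0 => /orP[/cards1P[v EB]|/eqP/cards0_eq EB]; last first.
    by have := domB (Ordinal n_gt0); rewrite EB !inE.
  have n_gt3 : 3 < n by move: leBs lts; rewrite EB cards1; clear; lia.
  have := domB (around v 1); rewrite EB !inE !around_add.
  have E j : 0 < j < n -> (around v j == v) = false.
    by case/andP=> j_gt0 ltj; rewrite (around_eq v ltj n_gt0) gtn_eqF.
  by rewrite !E //; lia.
(* The base vertex [x] is chosen by the answer to the first offer. *)
pose P D S := (D = set0 /\ S = set0) \/
  [disjoint D & S] /\ exists x, stuck x D S \/ oriented x D S.
apply: (@staller_invariant _ P); last by left.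
- move=> D S [[-> _]|[dDS [x [stk|ori]]]].
  + apply: (@not_occupies_le _ (Ordinal n_gt0) 0).
    by move=> j _; rewrite inE.
  + exact: stuck_not_occupies stk.
  + exact: oriented_not_occupies ori.
move=> D S u v [[-> ->] _ _ uv|[dDS [x stor]] uU vU uv].
  have [k ltk Ek] := around_surj u v.
  have k_gt0 : 0 < k by rewrite lt0n; apply: contraNneq uv => k0; rewrite Ek k0.
  rewrite !setU0; rewrite /P.
  have dis w w' : w != w' -> [disjoint [set w] & [set w']].
    by move=> ww'; rewrite disjoints1 inE.
  have [k1|k1] := eqVneq k 1.
    right; right; split; first exact: dis.
    by exists (ordS u); right; rewrite Ek k1; apply: first_adjacent; lia.
  have [kn|kn] := eqVneq k.+1 n.
    left; right; split; first by rewrite dis // eq_sym.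
    have -> : u = ordS v by rewrite Ek -aroundS kn around_wrap.
    by exists (ordS v); right; apply: first_adjacent; lia.
  have [ltk2|gek2] := ltnP k.+2 n.
    left; right; split; first by rewrite dis // eq_sym.
    by exists (around u (n - 2)); left; rewrite Ek; apply: first_far; lia.
  (* Here [k = n - 2]: seen from [v], the vertex [u] is only two steps ahead, so the roles are
     swapped. *)
  right; right; split; first exact: dis.
  have -> : u = around v 2.
    by rewrite Ek around_add -{1}(around_wrap u); congr around; lia.
  by exists (around v (n - 2)); left; apply: first_far; lia.
have move_lt a b : a < b < n -> free x D S a -> free x D S b ->
    P (around x b |: D) (around x a |: S) \/ P (around x a |: D) (around x b |: S).
  move=> /andP[ltab ltb] fra frb; have lta := ltn_trans ltab ltb.
  have neq_ab : around x a != around x b by rewrite around_eq // ltn_eqF.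
  have dba : [disjoint around x b |: D & around x a |: S].
    by apply: disjoint_move; rewrite ?inE ?negb_or // eq_sym.
  have dab : [disjoint around x a |: D & around x b |: S].
    by apply: disjoint_move; rewrite ?inE ?negb_or.
  have ltabn : a < b < n by rewrite ltab.
  case: stor => [stk|ori].
    case: (stuck_move dDS ltabn fra frb stk) => st; [left|right]; right.
      by split=> //; exists x; left.
    by split=> //; exists x; left.
  case: (oriented_move ori ltabn fra frb) => [st|or]; [left|right]; right.
    by split=> //; exists x; left.
  by split=> //; exists x; right.
have [[a lta Ea] [b ltb Eb]] := (around_surj x u, around_surj x v).
move: uU vU uv; rewrite Ea Eb !inE !negb_or around_eq // neq_ltn => fra frb.
case/orP=> lt_ab; first by apply: move_lt; rewrite ?lt_ab.
by apply/or_comm/move_lt; rewrite ?lt_ab.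
Qed.

End CycleGame.

Theorem theorem1p8 (n : nat) (hn : 3 <= n) :
  gammaWC (@cycle_graph n) = Some n./2 /\ sWC (@cycle_graph n) = Some n./2.
Proof.
split; apply: least_eq => [|k ltk].
- apply: waiter_can_mono (waiter_can_cycle hn) => B /existsP[C /and3P[sCB dC _]].
  by apply/existsP; exists C; rewrite sCB.
- apply/negP => /waiter_can_occupies_le; rewrite cards0 add0n => can.
  have /can : [disjoint (set0 : {set 'I_n}) & set0] by rewrite -setI_eq0 setI0.
  by apply/negP/waiter_cannot_cycle.
- apply: waiter_can_le (waiter_can_cycle hn).
  by rewrite card_ord uphalf_half leq_addl.
- exact: waiter_cannot_cycle.
Qed.
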